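(* Let $\alpha,\beta$ be real numbers such that $\alpha+\beta$ and $\alpha\beta$ are integers, and $\alpha\beta\neq 0$, $\alpha\neq\pm\beta$. Then $|\Phi_d(\alpha,\beta)|>1$ for $d>2$, and the only strong divisibility sequences among the sequences $S_n^\Lambda=S_n^\Lambda(\alpha,\beta)$, with $\Lambda\subset\mathbb{N}$ a finite saturated set, are the classical ones $S_{Nn}/S_N$, $N\geq 1$.
   Context: $\mathbb{N}$ denotes the positive integers. A set $\Lambda\subset\mathbb{N}$ is saturated if $d\mid h$ and $h\in\Lambda$ imply $d\in\Lambda$. $\Phi_d(x)$ is the $d$-th cyclotomic polynomial, $\Phi_d(x,y):=y^{\deg(\Phi_d)}\Phi_d(x/y)$ is its homogenization (a polynomial in two variables), and $\Phi_\Lambda(x,y):=\prod_{d\in\Lambda}\Phi_d(x,y)$. Define $S_n^\Lambda(\alpha,\beta):=\dfrac{\Phi_\Lambda(\alpha^n,\beta^n)}{\Phi_\Lambda(\alpha,\beta)}$ and $S_n=S_n(\alpha,\beta):=S_n^{\{1\}}(\alpha,\beta)=\dfrac{\alpha^n-\beta^n}{\alpha-\beta}$. The sequence $S_{Nn}/S_N$ is $S_n^{\Lambda}$ for $\Lambda$ the set of all positive divisors of $N$. A sequence of integers $a_n$ is a strong divisibility sequence if $\gcd(a_m,a_n)=a_{\gcd(m,n)}$ for all positive integers $m,n$. *)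

(* Defs.v *)
From mathcomp Require Import all_boot all_order all_algebra all_field.
From mathcomp Require Import finmap ring reals.

Set Implicit Arguments.
Unset Strict Implicit.
Unset Printing Implicit Defensive.

Import Order.TTheory GRing.Theory Num.Theory.

Local Open Scope ring_scope.

(* Value at (x, y) of the two-variable homogenization of p.  Written with the
   coefficients of p so that it is a polynomial in x and y, also at y = 0;
   [homog_evalE] relates it to y ^ deg p * p (x / y). *)
Definition homog_eval (R : realType) (p : {poly int}) (x y : R) : R :=
  \sum_(i < size p) (p`_i)%:~R * x ^+ i * y ^+ ((size p).-1 - i).

Lemma homog_evalE (R : realType) (p : {poly int}) (x y : R) : y != 0 ->
  homog_eval p x y = y ^+ (size p).-1 * (map_poly intr p).[x / y].
Proof.
move=> y0; rewrite horner_coef size_map_inj_poly ?rmorph0 //; last exact: intr_inj.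
rewrite mulr_sumr; apply: eq_bigr => i _.
have le_i : (i <= (size p).-1)%N by rewrite -ltnS (leq_trans (ltn_ord i)) ?leqSpred.
rewrite coef_map /= expr_div_n.
have -> : y ^+ (size p).-1 = y ^+ ((size p).-1 - i) * y ^+ i.
  by rewrite -exprD subnK.
have yi0 : y ^+ i != 0 by rewrite expf_neq0.
by field.
Qed.

Definition Phi (R : realType) (d : nat) (x y : R) : R := homog_eval 'Phi_d x y.

Definition PhiL (R : realType) (L : {fset nat}) (x y : R) : R :=
  \prod_(d <- L) Phi d x y.

Definition cycS (R : realType) (L : {fset nat}) (a b : R) (n : nat) : R :=
  PhiL L (a ^+ n) (b ^+ n) / PhiL L a b.

Definition lucasS (R : realType) (a b : R) (n : nat) : R := cycS [fset 1%N]%fset a b n.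

Lemma lucasSE (R : realType) (a b : R) (n : nat) :
  lucasS a b n = (a ^+ n - b ^+ n) / (a - b).
Proof.
have Phi1E : 'Phi_1 = 'X - 1%:P :> {poly int}.
  by rewrite -['X]expr1 -prod_Cyclotomic // big_seq1.
have PhiL1 (x y : R) : PhiL [fset 1%N]%fset x y = x - y.
  rewrite /PhiL big_seq_fset1 /Phi /homog_eval Phi1E size_XsubC.
  rewrite !big_ord_recl big_ord0 /= !coefB !coefX !coefC /=.
  by rewrite addr0 !expr1 !expr0 !mulr1 subr0 sub0r mulrN1z mul1r mulN1r addrC.
by rewrite /lucasS /cycS !PhiL1.
Qed.

(* Saturated sets consist of positive integers, hence the first clause. *)
Definition saturated (L : {fset nat}) : Prop :=
  (forall d, d \in L -> (0 < d)%N) /\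
  (forall d h : nat, (d %| h)%N -> h \in L -> d \in L).

(* Only the terms of positive index matter.  A gcd in the integers is defined
   up to sign: the condition says that u (gcd (m, n)) is a gcd of u m and u n,
   whatever the signs of the terms (gcdz is the nonnegative gcd). *)
Definition strong_divisibility (R : realType) (u : nat -> R) : Prop :=
  exists a : nat -> int,
    (forall n, (0 < n)%N -> u n = (a n)%:~R) /\
    (forall m n, (0 < m)%N -> (0 < n)%N ->
       gcdz (a m) (a n) = `|a (gcdn m n)|).

(* Main.v *)
(* First part: |Phi_d(a, b)| is the product of the |a - z b| over the primitive
   d-th roots of unity z = u + i v.  For d > 2 such a z is not real, and
   |a - z b|^2 = (1+u)/2 (a-b)^2 + (1-u)/2 (a+b)^2 is a strict convex combination
   of two positive integers that are not both 1, hence exceeds 1.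

   Second part: since Phi_d(x^n) is the product of the Phi_e(x) over the e with
   e / gcd(e, n) = d, the term S_n^L is the product of the integers Phi_e(a, b)
   over the e outside L with e / gcd(e, n) in L.  If L is not closed under lcm,
   a minimal e outside L dividing the lcm of two elements of L is not a prime
   power, so it has distinct prime factors p and q with e/p and e/q in L.  Then
   Phi_e(a, b), which is not a unit, divides both S_p and S_q, although
   gcd(S_p, S_q) = S_1 = 1.  Hence L is closed under lcm and consists of the
   divisors of one N. *)
Require Import Defs.
From mathcomp Require Import all_boot all_order all_algebra all_field.
From mathcomp Require Import finmap ring lra reals complex.

Set Implicit Arguments.
Unset Strict Implicit.
Unset Printing Implicit Defensive.

Import Order.TTheory GRing.Theory Num.Theory.
Local Open Scope ring_scope.

(** * Roots of cyclotomic polynomials in a field *)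

Lemma divisors_perm_filter (e d : nat) : (0 < d)%N -> (e %| d)%N ->
  perm_eq (divisors e) [seq k <- divisors d | (k %| e)%N].
Proof.
move=> d0 ed; have e0 := dvdn_gt0 d0 ed.
apply: uniq_perm; rewrite ?filter_uniq ?divisors_uniq // => k.
rewrite mem_filter -!dvdn_divisors //; case: (boolP (k %| e)%N) => //= ke.
by rewrite (dvdn_trans ke).
Qed.

(** The cyclotomic factorization of the separable ['X^d - 1] splits into ['X^e - 1] and a cofactor
    containing ['Phi_d]; these are coprime, so they share no root. *)
Lemma root_Cyclotomic_expr_neq1 (F : fieldType) (d e : nat) (z : F) :
  d%:R != 0 :> F -> (e %| d)%N -> e != d ->
  root (map_poly intr 'Phi_d) z -> z ^+ e != 1.
Proof.
move=> dF ed ne_ed rz; apply/eqP => ze1.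
have d0 : (0 < d)%N by rewrite lt0n; apply: contraNneq dF => ->.
have e0 := dvdn_gt0 d0 ed.
have XnE n : map_poly intr ('X^n - 1 : {poly int}) = 'X^n - 1 :> {poly F}.
  by rewrite rmorphB /= map_polyXn rmorph1.
have := separable_Xn_sub_1 dF; rewrite -XnE -prod_Cyclotomic //.
rewrite (bigID (fun k => k %| e)%N) /= -[X in X * _]big_filter.
rewrite -(perm_big _ (divisors_perm_filter d0 ed)) prod_Cyclotomic //=.
rewrite (big_rem d) ?divisors_id //= ifT; last first.
  by apply: contra ne_ed => /(conj ed)/andP; rewrite -eqn_dvd.
rewrite !rmorphM /= XnE !separable_mul => /and3P[_ _].
rewrite coprimepMr => /andP[/coprimep_root -/(_ z)].
rewrite rootE !hornerE ze1 subrr eqxx => /(_ isT) + _.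
by rewrite (eqP rz) eqxx.
Qed.

Lemma root_Cyclotomic_unity (F : fieldType) (d : nat) (z : F) : (0 < d)%N ->
  root (map_poly intr 'Phi_d) z -> z ^+ d = 1.
Proof.
move=> d0 rz; apply/eqP; rewrite -subr_eq0.
have XnE : map_poly intr ('X^d - 1 : {poly int}) = 'X^d - 1 :> {poly F}.
  by rewrite rmorphB /= map_polyXn rmorph1.
have := congr1 (horner^~ z) XnE; rewrite !hornerE => <-.
rewrite -prod_Cyclotomic // (big_rem d) ?divisors_id //= rmorphM /= hornerM.
by rewrite (eqP rz) mul0r.
Qed.

(** For even [d], 2 is a proper divisor of [d]. For odd [d], [z ^+ 2 = 1] and [z ^+ d = 1] give
    [z = 1], which the proper divisor 1 excludes. *)
Lemma root_Cyclotomic_sqr_neq1 (F : numFieldType) (d : nat) (z : F) :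
  (2 < d)%N -> root (map_poly intr 'Phi_d) z -> z ^+ 2 != 1.
Proof.
move=> d2 rz; have d0 : (0 < d)%N by apply: leq_trans d2.
have dF : d%:R != 0 :> F by rewrite pnatr_eq0 -lt0n.
case: (boolP (odd d)) => od; last first.
  by apply: (root_Cyclotomic_expr_neq1 dF _ _ rz); rewrite ?dvdn2 // ltn_eqF.
apply/eqP => z2; have := root_Cyclotomic_unity d0 rz.
rewrite -(odd_double_half d) od -mul2n exprD exprM z2 expr1n mulr1.
apply/eqP; apply: (root_Cyclotomic_expr_neq1 dF _ _ rz) => //.
by rewrite ltn_eqF // (leq_trans _ d2).
Qed.

(** * The lower bound on cyclotomic values *)

Lemma complex_norm_sub_gt1 (R : realType) (a b : R) (z : R[i]) :
  a + b \is a Num.int -> a * b \is a Num.int ->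
  a * b != 0 -> a != b -> a != - b -> `|z| = 1 -> z ^+ 2 != 1 ->
  1 < `|a%:C%C - b%:C%C * z|.
Proof.
move=> abZ mZ m0 ne_ab ne_aNb z1 z21.
have sqr_ge1 (t : R) : t ^+ 2 \is a Num.int -> t != 0 -> 1 <= t ^+ 2.
  by move=> tZ t0; rewrite -[t ^+ 2]ger0_norm ?sqr_ge0 // norm_intr_ge1 ?sqrf_eq0.
have p1 : 1 <= (a + b) ^+ 2 by rewrite sqr_ge1 ?rpredX // addr_eq0.
have m1 : 1 <= (a - b) ^+ 2.
  rewrite sqr_ge1 ?subr_eq0 //.
  (* [a - b] need not be an integer, but its square is the discriminant. *)
  have -> : (a - b) ^+ 2 = (a + b) ^+ 2 - 4 * (a * b) by ring.
  by rewrite rpredB ?rpredX // rpredM ?rpred_nat.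
case: z z1 z21 => u v z1 z21.
have uv1 : u ^+ 2 + v ^+ 2 = 1.
  by apply: (@complexI R); rewrite (add_Re2_Im2 (u +i* v)%C) z1 expr1n.
have u1 : u ^+ 2 < 1.
  rewrite lt_neqAle -{2}uv1 lerDl sqr_ge0 andbT; apply: contraNneq z21 => u1.
  have v0 : v = 0.
    by apply/eqP; rewrite -sqrf_eq0; apply/eqP/(addrI (u ^+ 2)); rewrite uv1 u1 addr0.
  by rewrite v0 complexr0 -rmorphXn /= u1.
have [uN1 uP1] : -1 < u /\ u < 1 by split; nra.
rewrite -(@ltr_pXn2r _ 2) ?nnegrE // expr1n -add_Re2_Im2 ltcR /=.
have -> : (a - (b * u - 0 * v)) ^+ 2 + (0 - (b * v + 0 * u)) ^+ 2 =
    1 + ((1 + u) * ((a - b) ^+ 2 - 1) + (1 - u) * ((a + b) ^+ 2 - 1)) / 2.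
  have -> : (0 - (b * v + 0 * u)) ^+ 2 = b ^+ 2 * (1 - u ^+ 2) by rewrite -uv1; ring.
  by field.
(* The two squares differ by [4 * (a * b)], which is nonzero, so one of them exceeds 1. *)
rewrite ltrDl divr_gt0 //; have [m_gt1|m_le1] := ltP 1 ((a - b) ^+ 2).
  by rewrite ltr_wpDr ?mulr_ge0 ?mulr_gt0 //; lra.
by rewrite ltr_wpDl ?mulr_ge0 ?mulr_gt0 //; lra.
Qed.

Lemma homog_eval_complex (R : realType) (p : {poly int}) (x y : R) (r : seq R[i]) :
  y != 0 -> map_poly intr p = \prod_(z <- r) ('X - z%:P) :> {poly R[i]} ->
  (homog_eval p x y)%:C%C = \prod_(z <- r) (x%:C%C - y%:C%C * z).
Proof.
move=> y0 pE; have y0' : y%:C%C != 0 :> R[i] by rewrite (fmorph_eq0 (real_complex R)).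
have sE : size p = (size r).+1.
  rewrite -(size_prod_XsubC _ id) -pE size_map_inj_poly ?rmorph0 //; exact: intr_inj.
rewrite homog_evalE // sE /= rmorphM rmorphXn /= -horner_map /= -map_poly_comp /=.
rewrite (eq_map_poly (g := intr)); last by move=> k; rewrite /= rmorph_int.
rewrite pE horner_prod rmorphM fmorphV /=; elim: r {pE sE} => [|z r IHr].
  by rewrite !big_nil mulr1.
rewrite !big_cons -IHr /= exprS mulrACA !hornerE; congr (_ * _).
by rewrite mulrBr [_ * (_ / _)]mulrC divfK.
Qed.

Lemma Phi_norm_gt1 (R : realType) (a b : R) (d : nat) :
  a + b \is a Num.int -> a * b \is a Num.int ->
  a * b != 0 -> a != b -> a != - b -> (2 < d)%N -> 1 < `|Phi d a b|.
Proof.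
move=> abZ mZ m0 ne_ab ne_aNb d2.
have d0 : (0 < d)%N by apply: leq_trans d2.
have b0 : b != 0 by apply: contraNneq m0 => ->; rewrite mulr0.
have [r] := closed_field_poly_normal (map_poly intr 'Phi_d : {poly R[i]}).
rewrite (monicP _) ?scale1r; last by rewrite monic_map ?Cyclotomic_monic.
move=> rE; have rootr z : z \in r -> root (map_poly intr 'Phi_d) z.
  by rewrite rE root_prod_XsubC.
rewrite -ltcR; have -> : (`|Phi d a b|)%:C%C = `|(Phi d a b)%:C%C| :> R[i].
  by rewrite normc_def /= expr0n addr0 sqrtr_sqr.
rewrite /Phi (homog_eval_complex _ b0 rE) normr_prod.
have -> : (1%:C)%C = \prod_(z <- r) (1 : R[i]) by rewrite big1_eq.
rewrite big_seq [X in _ < X]big_seq; apply: ltr_prod => [|z zr].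
  (* Strictness for products needs at least one factor: [r] has [totient d] entries, a positive
     number. *)
  apply/hasP.
  case: r rE {rootr} => [|z r rE]; last by exists z; rewrite mem_head.
  move/(congr1 (size \o polyseq)); rewrite /= big_nil size_poly1.
  rewrite size_map_inj_poly ?rmorph0 ?size_Cyclotomic //; last exact: intr_inj.
  by case; have := totient_gt0 d; rewrite d0; case: totient.
rewrite ler01 complex_norm_sub_gt1 // ?(root_Cyclotomic_sqr_neq1 d2) ?rootr //.
apply/eqP; rewrite -(@pexpr_eq1 _ _ d) // -normrX.
by rewrite (root_Cyclotomic_unity d0) ?normr1 ?rootr.
Qed.

(** * Products over divisors, and values at powers *)

Lemma homog_evalM (R : realType) (p q : {poly int}) (x y : R) :
  y != 0 -> p != 0 -> q != 0 ->
  homog_eval (p * q) x y = homog_eval p x y * homog_eval q x y.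
Proof.
move=> y0 p0 q0; rewrite !homog_evalE // rmorphM hornerM size_mul //.
have -> : (size p + size q).-2 = ((size p).-1 + (size q).-1)%N.
  by move: p0 q0; rewrite -!size_poly_gt0 => /prednK<- /prednK<-; rewrite addnS.
by rewrite exprD mulrACA.
Qed.

Lemma homog_eval_prod (R : realType) (I : Type) (r : seq I) (P : I -> {poly int})
    (x y : R) : y != 0 -> (forall i, P i != 0) ->
  homog_eval (\prod_(i <- r) P i) x y = \prod_(i <- r) homog_eval (P i) x y.
Proof.
move=> y0 P0; elim: r => [|i r IHr].
  by rewrite !big_nil homog_evalE // rmorph1 hornerC size_poly1 mulr1.
rewrite !big_cons homog_evalM ?IHr //.
by apply: (big_ind (fun p => p != 0)) => // [|p q]; [exact: oner_neq0|exact: mulf_neq0].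
Qed.

Lemma prod_Phi (R : realType) (x y : R) (m : nat) : y != 0 -> (0 < m)%N ->
  \prod_(d <- divisors m) Phi d x y = x ^+ m - y ^+ m.
Proof.
move=> y0 m0; rewrite -homog_eval_prod //; last first.
  by move=> d; rewrite monic_neq0 ?Cyclotomic_monic.
rewrite prod_Cyclotomic // homog_evalE // size_XnsubC //= rmorphB /=.
rewrite map_polyXn rmorph1 !hornerE mulrBr mulr1 expr_div_n mulrC divfK //.
by rewrite expf_neq0.
Qed.

(** Multiplicative Möbius inversion by strong induction: the factors at proper divisors agree and,
    being nonzero, cancel. *)
Lemma divisors_prod_inj (F : idomainType) (u v : nat -> F) :
  (forall d, (0 < d)%N -> v d != 0) ->
  (forall m, (0 < m)%N ->
     \prod_(d <- divisors m) u d = \prod_(d <- divisors m) v d) ->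
  forall d, (0 < d)%N -> u d = v d.
Proof.
move=> v0 uv; elim/ltn_ind => d IHd d0; have := uv d d0.
rewrite !(big_rem d (divisors_id d0)) /=.
have memE k : k \in rem d (divisors d) -> (0 < k < d)%N.
  rewrite mem_rem_uniq ?divisors_uniq // !inE -dvdn_divisors // => /andP[kd kdvd].
  by rewrite (dvdn_gt0 d0 kdvd) ltn_neqAle kd dvdn_leq.
rewrite (eq_big_seq v) => [|k /memE/andP[k0 kd]]; last exact: IHd.
apply: mulIf; rewrite big_seq_cond; rewrite prodf_seq_neq0; apply/allP => k _ /=.
by rewrite andbT; apply/implyP => /memE/andP[k0 _]; apply: v0.
Qed.

Lemma Phi_neq0 (R : realType) (x y : R) (d : nat) : y != 0 -> (0 < d)%N ->
  x ^+ d != y ^+ d -> Phi d x y != 0.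
Proof.
move=> y0 d0; apply: contraNneq => Phi0.
by rewrite -subr_eq0 -prod_Phi // (big_rem d) ?divisors_id //= Phi0 mul0r.
Qed.

Lemma PhiL_neq0 (R : realType) (L : {fset nat}) (x y : R) :
  (forall d, d \in L -> (0 < d)%N) -> y != 0 ->
  (forall k, (0 < k)%N -> x ^+ k != y ^+ k) -> PhiL L x y != 0.
Proof.
move=> L0 y0 xy; rewrite /PhiL big_seq prodf_seq_neq0; apply/allP => d dL.
by rewrite dL Phi_neq0 ?xy ?L0.
Qed.

(** Swapping [x] and [y] negates every [x ^+ m - y ^+ m]; inversion over divisors puts this sign on
    the index 1 alone. *)
Lemma Phi_sym (R : realType) (x y : R) (d : nat) : x != 0 -> y != 0 ->
  (forall m, (0 < m)%N -> x ^+ m != y ^+ m) -> (1 < d)%N ->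
  Phi d y x = Phi d x y.
Proof.
move=> x0 y0 xy d1.
pose s (k : nat) : R := if k == 1%N then -1 else 1.
suff : Phi d y x = s d * Phi d x y by rewrite /s gtn_eqF ?mul1r.
apply: (divisors_prod_inj (u := fun k => Phi k y x)
  (v := fun k => s k * Phi k x y)); last exact: ltnW.
- move=> k k0; rewrite mulf_neq0 ?Phi_neq0 ?xy // /s.
  by case: ifP; rewrite ?oppr_eq0 oner_eq0.
move=> m m0; rewrite big_split /= !prod_Phi //.
suff -> : \prod_(k <- divisors m) s k = -1 by rewrite mulN1r opprB.
rewrite (big_rem _ (divisor1 m)) /= big1_seq ?mulr1 // => k.
by rewrite /= mem_rem_uniq ?divisors_uniq // !inE /s => /andP[/negPf ->].
Qed.

Lemma prod_fibers (F : comPzSemiRingType) (I J : eqType) (s : seq I) (t : seq J)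
    (f : I -> J) (G : I -> F) : uniq t ->
  \prod_(j <- t) \prod_(i <- s | f i == j) G i = \prod_(i <- s | f i \in t) G i.
Proof.
move=> ut; rewrite [RHS]big_mkcond (exchange_big_dep xpredT) //=.
apply: eq_bigr => i _; case: ifP => [fit|/negP fit].
  rewrite -big_filter; set l := filter _ _; suff -> : l = [:: f i] by rewrite big_seq1.
  apply: perm_small_eq => //; apply: uniq_perm; rewrite ?filter_uniq // => j.
  by rewrite mem_filter inE eq_sym; case: eqP => // ->.
by rewrite big1_seq // => j /andP[/eqP <-].
Qed.

(** After division by the gcd, Gauss's lemma applies. The quotient is the order of the [n]-th power
    of an element of order [e], whence its role as an index below. *)
Lemma dvdn_div_gcdn (e n d : nat) : (0 < n)%N ->
  (e %| n * d)%N = (e %/ gcdn e n %| d)%N.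
Proof.
move=> n0; have g0 : (0 < gcdn e n)%N by rewrite gcdn_gt0 n0 orbT.
have cop : coprime (e %/ gcdn e n) (n %/ gcdn e n).
  by rewrite /coprime -(eqn_pmul2r g0) muln_gcdl !divnK ?dvdn_gcdl ?dvdn_gcdr // mul1n.
rewrite -[X in (_ %| X * d)%N = _](divnK (dvdn_gcdr e n)).
rewrite -[X in (X %| _)%N = _](divnK (dvdn_gcdl e n)).
by rewrite mulnAC dvdn_pmul2r // Gauss_dvdr.
Qed.

(** Any [e] with [e %/ gcdn e n = d] already divides [n * d], so one range can serve all divisors
    [d] of [m]. *)
Lemma divisors_fiber (n d m : nat) : (0 < n)%N -> (0 < m)%N -> (d %| m)%N ->
  perm_eq [seq e <- divisors (n * d) | (e %/ gcdn e n == d)%N]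
          [seq e <- divisors (n * m) | (e %/ gcdn e n == d)%N].
Proof.
move=> n0 m0 dm; have d0 := dvdn_gt0 m0 dm.
apply: uniq_perm; rewrite ?filter_uniq ?divisors_uniq // => e.
rewrite !mem_filter -!dvdn_divisors ?muln_gt0 ?n0 // !dvdn_div_gcdn //.
by case: eqP => // ->; rewrite dvdnn dm.
Qed.

(** Inversion over divisors again: as [d] runs over the divisors of [m], the fibers partition the
    divisors of [n * m], and both products equal [x ^+ (n * m) - y ^+ (n * m)]. *)
Lemma Phi_expr (R : realType) (x y : R) (n m d : nat) : y != 0 ->
  (forall k, (0 < k)%N -> x ^+ k != y ^+ k) ->
  (0 < n)%N -> (0 < m)%N -> (d %| m)%N ->
  Phi d (x ^+ n) (y ^+ n) =
  \prod_(e <- divisors (n * m) | (e %/ gcdn e n == d)%N) Phi e x y.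
Proof.
move=> y0 xy n0 m0 dm; have d0 := dvdn_gt0 m0 dm.
(* The range becomes the divisors of [n * d], so that both sides depend on [d] alone, as inversion
   requires. *)
rewrite -big_filter -(perm_big _ (divisors_fiber n0 m0 dm)) big_filter.
apply/esym; move: d d0 {m m0 dm}; apply: divisors_prod_inj => [d d0|m m0].
  by rewrite Phi_neq0 ?expf_neq0 // -!exprM xy ?muln_gt0 ?n0.
rewrite prod_Phi ?expf_neq0 // -!exprM -prod_Phi ?muln_gt0 ?n0 //.
have fibE d : d \in divisors m ->
    \prod_(e <- divisors (n * d) | (e %/ gcdn e n == d)%N) Phi e x y =
    \prod_(e <- divisors (n * m) | (e %/ gcdn e n == d)%N) Phi e x y.
  rewrite -dvdn_divisors // => dm.
  by rewrite -big_filter (perm_big _ (divisors_fiber n0 m0 dm)) big_filter.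
rewrite (eq_big_seq _ fibE) prod_fibers ?divisors_uniq // big_seq_cond [RHS]big_seq.
apply: eq_bigl => e; rewrite -!dvdn_divisors ?muln_gt0 ?n0 // -dvdn_div_gcdn //.
by rewrite andbb.
Qed.

(** * Integrality of cyclotomic values *)

(* If the roots a != b of a monic quadratic over the integers are not rational,
   this says that x and y are conjugate elements of the ring Z[a]. *)
Definition conj_pair (R : realType) (a b x y : R) : Prop :=
  exists u v : int, x = u%:~R + v%:~R * a /\ y = u%:~R + v%:~R * b.

Lemma conj_pair_homog_eval (R : realType) (a b : R) (p : {poly int}) :
  a + b \is a Num.int -> a * b \is a Num.int ->
  conj_pair a b (homog_eval p a b) (homog_eval p b a).
Proof.
move=> /intrP[S SE] /intrP[Q QE].
have cD x y x' y' : conj_pair a b x y -> conj_pair a b x' y' ->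
    conj_pair a b (x + x') (y + y').
  move=> [u [v [-> ->]]] [u' [v' [-> ->]]]; exists (u + u'), (v + v').
  by rewrite !rmorphD; split; ring.
have cM x y x' y' : conj_pair a b x y -> conj_pair a b x' y' ->
    conj_pair a b (x * x') (y * y').
  move=> [u [v [-> ->]]] [u' [v' [-> ->]]].
  (* Reduction by [a ^+ 2 = S * a - Q], and likewise for [b]. *)
  exists (u * u' - v * v' * Q), (u * v' + u' * v + v * v' * S).
  by rewrite !(intrD, intrM, rmorphN) /= !intrM -SE -QE; split; ring.
have cZ k : conj_pair a b k%:~R k%:~R by exists k, 0; rewrite !mul0r addr0.
have cX x y n : conj_pair a b x y -> conj_pair a b (x ^+ n) (y ^+ n).
  by move=> xy; elim: n => [|n IHn]; rewrite ?exprS; [exact: (cZ 1)|exact: cM].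
have cab : conj_pair a b a b by exists 0, 1; rewrite !add0r !mul1r.
have cba : conj_pair a b b a by exists S, (-1); rewrite -SE; split; ring.
rewrite /homog_eval; apply: (big_ind2 (conj_pair a b)) => [||i _].
- exact: (cZ 0).
- by move=> *; apply: cD.
by apply: (cM) (cX _ _ _ cba); apply: (cM) (cZ _) (cX _ _ _ cab).
Qed.

(** By symmetry the value equals its conjugate, so its coefficient [v] on [a] vanishes. *)
Lemma Phi_int (R : realType) (a b : R) (d : nat) :
  a + b \is a Num.int -> a * b \is a Num.int -> a != 0 -> b != 0 ->
  (forall m, (0 < m)%N -> a ^+ m != b ^+ m) -> (1 < d)%N ->
  Phi d a b \is a Num.int.
Proof.
move=> sZ mZ a0 b0 ab d1.
have [u [v [ua ub]]] := conj_pair_homog_eval 'Phi_d sZ mZ.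
have := Phi_sym a0 b0 ab d1; rewrite /Phi ua ub => /addrI/eqP.
rewrite -subr_eq0 -mulrBr mulf_eq0 subr_eq0 => /orP[/eqP->|/eqP ba].
  by rewrite mul0r addr0 intr_int.
by have := ab 1%N isT; rewrite ba eqxx.
Qed.

(** * Saturated sets and least common multiples *)

Lemma saturated_nonlcm (L : {fset nat}) : saturated L -> 1%N \in L ->
  forall a b, a \in L -> b \in L -> lcmn a b \notin L ->
  exists e p q, [/\ prime p, prime q, p != q, (p %| e)%N & (q %| e)%N] /\
    [/\ e \notin L, (e %/ p)%N \in L & (e %/ q)%N \in L].
Proof.
move=> [L0 Lsat] L1 a b aL bL abL.
have exP : exists e, (e %| lcmn a b)%N && (e \notin L).
  by exists (lcmn a b); rewrite dvdnn.
case: (ex_minnP exP) => e /andP[eab eL] emin.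
have l0 : (0 < lcmn a b)%N by rewrite lcmn_gt0 !L0.
have e0 : (0 < e)%N := dvdn_gt0 l0 eab.
have e1 : (1 < e)%N by rewrite ltn_neqAle e0 andbT; apply: contraNneq eL => <-.
have divL p : prime p -> (p %| e)%N -> (e %/ p)%N \in L.
  move=> pp pe; apply: contraT => epL.
  have := emin (e %/ p)%N.
  rewrite epL andbT (dvdn_trans _ eab) ?dvdn_div // => /(_ isT).
  by rewrite leqNgt ltn_Pdiv ?prime_gt1.
have pp := pdiv_prime e1; have pe := pdiv_dvd e; set p := pdiv e in pp pe.
(* A prime power dividing [lcmn a b] divides [a] or [b], since valuations of an lcm are maxima;
   saturation would then put [e] in [L]. *)
have [eP|] := boolP (p.-nat e)%N.
  case/negP: eL; have [k ek] := p_natP eP.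
  have : (e %| a)%N || (e %| b)%N.
    move: eab; rewrite ek (pfactor_dvdn _ pp l0) !pfactor_dvdn ?L0 // logn_lcm ?L0 //.
    by rewrite leq_max.
  by case/orP => [/Lsat|/Lsat]; apply.
rewrite /pnat e0 /= => /allPn[q]; rewrite mem_primes => /and3P[qp _ qe] qnp.
exists e, p, q; split; last by rewrite !divL.
by split=> //; rewrite eq_sym.
Qed.

(** Over the reals, equal [m]-th powers have bases of equal absolute value. This keeps all
    denominators nonzero. *)
Lemma expr_neq_of_neq (R : realType) (a b : R) (m : nat) :
  a != b -> a != - b -> (0 < m)%N -> a ^+ m != b ^+ m.
Proof.
move=> ab aNb m0; apply/eqP => /(congr1 Num.norm); rewrite !normrX => /eqP.
by rewrite eqrXn2 // eqr_norm2 (negPf ab) (negPf aNb).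
Qed.

Lemma biglcmn_fset_gt0 (L : {fset nat}) : (forall d, d \in L -> (0 < d)%N) ->
  (0 < \big[lcmn/1]_(d <- L) d)%N.
Proof.
move=> L0; rewrite big_seq; apply: (big_ind (fun n => 0 < n)%N) => // m n.
by rewrite lcmn_gt0 => -> ->.
Qed.

Lemma dvdn_biglcmn_fset (L : {fset nat}) (d : nat) : d \in L ->
  (d %| \big[lcmn/1]_(k <- L) k)%N.
Proof. by move=> dL; rewrite (big_rem d) //= dvdn_lcml. Qed.

(** [N] is the lcm of all elements of [L], which itself lies in [L] by closure. *)
Lemma saturated_lcm_divisors (L : {fset nat}) : saturated L -> 1%N \in L ->
  (forall a b, a \in L -> b \in L -> lcmn a b \in L) ->
  exists2 N, (0 < N)%N & perm_eq L (divisors N).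
Proof.
move=> [L0 Lsat] L1 Llcm; exists (\big[lcmn/1]_(d <- L) d)%N.
  exact: biglcmn_fset_gt0.
apply: uniq_perm; rewrite ?fset_uniq ?divisors_uniq // => d.
rewrite -dvdn_divisors ?biglcmn_fset_gt0 //; apply/idP/idP.
  exact: dvdn_biglcmn_fset.
move/Lsat; apply; rewrite big_seq; exact: (big_ind (fun k => k \in L)).
Qed.

(** * Factorization of the terms of the sequence *)

(** In the expanded numerator, the indices [e] in [L] run over all of [L], by saturation, and cancel
    the denominator. *)
Lemma cycS_prod (R : realType) (L : {fset nat}) (a b : R) (n m : nat) :
  saturated L -> b != 0 -> (forall k, (0 < k)%N -> a ^+ k != b ^+ k) ->
  (0 < n)%N -> (0 < m)%N -> (forall d, d \in L -> (d %| m)%N) ->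
  cycS L a b n = \prod_(e <- divisors (n * m) |
    (e \notin L) && ((e %/ gcdn e n)%N \in L)) Phi e a b.
Proof.
move=> [L0 Lsat] b0 ab n0 m0 Lm; rewrite /cycS.
apply: (canLR (mulfK (PhiL_neq0 L0 b0 ab))); rewrite mulrC {1}/PhiL.
rewrite (eq_big_seq _ (fun d dL => Phi_expr b0 ab n0 m0 (Lm d dL))).
rewrite prod_fibers ?fset_uniq // (bigID (mem L)) /=; congr (_ * _); last first.
  by apply: eq_bigl => e; rewrite andbC.
rewrite -big_filter; apply/perm_big/uniq_perm.
- by rewrite filter_uniq ?divisors_uniq.
- exact: fset_uniq.
move=> e; rewrite mem_filter -dvdn_divisors ?muln_gt0 ?n0 //.
case: (boolP (e \in L)) => [eL|]; last by rewrite andbF.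
by rewrite (Lsat _ e) ?dvdn_div ?dvdn_gcdl // dvdn_mull ?Lm.
Qed.

Lemma Phi_dvd_cycS (R : realType) (L : {fset nat}) (a b : R) (n e : nat) :
  a + b \is a Num.int -> a * b \is a Num.int -> a != 0 -> b != 0 ->
  (forall k, (0 < k)%N -> a ^+ k != b ^+ k) ->
  saturated L -> 1%N \in L -> (0 < n)%N ->
  e \notin L -> (e %/ gcdn e n)%N \in L ->
  exists k : int, cycS L a b n = Phi e a b * k%:~R.
Proof.
move=> sZ mZ a0 b0 ab Lsat L1 n0 eL enL; have [L0 _] := Lsat.
set m := (\big[lcmn/1]_(d <- L) d)%N.
have m0 : (0 < m)%N by apply: biglcmn_fset_gt0.
rewrite (@cycS_prod _ _ _ _ _ m) //; last exact: dvdn_biglcmn_fset.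
have enm : e \in divisors (n * m).
  by rewrite -dvdn_divisors ?muln_gt0 ?n0 // dvdn_div_gcdn // dvdn_biglcmn_fset.
(* The remaining indices lie outside [L], hence differ from 1, and [Phi_int] applies to them. *)
rewrite (big_rem e) //= eL enL; suff /intrP[k ->] : 
  \prod_(y <- rem e (divisors (n * m)) |
    (y \notin L) && ((y %/ gcdn y n)%N \in L)) Phi y a b \is a Num.int by exists k.
rewrite big_seq_cond rpred_prod // => d /and3P[/mem_rem + dL _].
rewrite -dvdn_divisors ?muln_gt0 ?n0 // => dvd.
have d0 : (0 < d)%N by apply: dvdn_gt0 dvd; rewrite muln_gt0 n0.
by rewrite Phi_int // ltn_neqAle d0 andbT; apply: contraNneq dL => <-.
Qed.

(** * Strong divisibility forces closure under lcm *)

Theorem corollary5 (R : realType) (alpha beta : R)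
  (hsum : alpha + beta \is a Num.int) (hprod : alpha * beta \is a Num.int)
  (hprod0 : alpha * beta != 0) (hne : alpha != beta) (hneN : alpha != - beta) :
  (forall d : nat, (2 < d)%N -> 1 < `|Phi d alpha beta|) /\
  (forall L : {fset nat}, L != fset0%fset -> saturated L ->
     strong_divisibility (cycS L alpha beta) ->
     exists N : nat, (0 < N)%N /\
       forall n : nat, (0 < n)%N ->
         cycS L alpha beta n = lucasS alpha beta (N * n) / lucasS alpha beta N).
Proof.
have Phi_gt1 d : (2 < d)%N -> 1 < `|Phi d alpha beta| by apply: Phi_norm_gt1.
split=> // L Ln0 Lsat [a [aE agcd]].
have [alpha0 beta0] : alpha != 0 /\ beta != 0.
  by move: hprod0; rewrite mulf_eq0 negb_or => /andP.
have neX m := expr_neq_of_neq (m := m) hne hneN.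
have L1 : 1%N \in L.
  by have [d dL] := fset0Pn _ Ln0; apply: (Lsat.2 1%N d).
have PhiL0 := PhiL_neq0 Lsat.1 beta0 neX.
have [Llcm|] := boolP (all (fun x => all (fun y => lcmn x y \in L) L) L).
  have [|N N0 LN] := saturated_lcm_divisors Lsat L1.
    by move=> x y xL yL; move/allP/(_ x xL)/allP/(_ y yL): Llcm.
  exists N; split=> // n n0.
  (* When [L] is the set of divisors of [N], the cyclotomic product collapses to a difference of
     [N]-th powers. *)
  have PhiLE (x y : R) : y != 0 -> PhiL L x y = x ^+ N - y ^+ N.
    by move=> y0; rewrite /PhiL (perm_big _ LN) prod_Phi.
  have ab0 : alpha - beta != 0 by rewrite subr_eq0.
  rewrite !lucasSE /cycS !PhiLE ?expf_neq0 // -!exprM mulnC.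
  by rewrite invf_div mulrA divfK.
case/allPn => x xL /allPn[y yL xyL].
have [e [p [q [[pp qp pq pe qe] [eL epL eqL]]]]] := saturated_nonlcm Lsat L1 xL yL xyL.
(* If [e] were 0, then [e %/ p] would be 0 as well, both inside and outside [L]. *)
have e0 : (0 < e)%N by case: e eL epL {pe qe eqL} => //; rewrite div0n => /negPf ->.
have gcdE r : (r %| e)%N -> gcdn e r = r by move=> re; apply/gcdn_idPr.
have ubnd r : prime r -> (r %| e)%N -> (e %/ r)%N \in L ->
    exists k, cycS L alpha beta r = Phi e alpha beta * k%:~R.
  by move=> rp re erL; apply: Phi_dvd_cycS; rewrite ?gcdE ?prime_gt0.
(* Distinct primes [p] and [q] divide [e], so [e] is at least 4. *)
have e2 : (2 < e)%N.
  have : (p * q %| e)%N.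
    by rewrite Gauss_dvd ?pe ?qe // prime_coprime // dvdn_prime2.
  move/(dvdn_leq e0); apply: leq_trans.
  by rewrite (@leq_trans (2 * 2)) // leq_mul ?prime_gt1.
have /intrP[c cE] : Phi e alpha beta \is a Num.int.
  by apply: Phi_int => //; apply: ltnW.
have a1 : a 1%N = 1.
  apply: (@intr_inj R); rewrite -aE // /cycS !expr1 divff //.
have dvd_a r : prime r -> (r %| e)%N -> (e %/ r)%N \in L -> (c %| a r)%Z.
  move=> rp re erL; have [k] := ubnd r rp re erL.
  rewrite aE ?prime_gt0 // cE -intrM => /intr_inj ->.
  exact: dvdz_mulr.
have : (c %| gcdz (a p) (a q))%Z by rewrite dvdz_gcd !dvd_a.
have cop_pq : coprime p q by rewrite prime_coprime // dvdn_prime2.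
(* [c] divides the gcd of the terms at [p] and [q], which is the term at 1; so [c] is a unit,
   against the bound for [e]. *)
rewrite agcd ?prime_gt0 // (eqP cop_pq) a1 dvdz1 => /eqP c1.
by have := Phi_gt1 e e2; rewrite cE -intr_norm -abszE c1 ltxx.
Qed.
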